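(* If $E_1,E_2\subseteq\mathbb{Q}$ have positive upper Banach density, then $$(E_1-E_1)^2-(E_2-E_2)^2=\mathbb{Q}.$$
   Context: For $A,B\subseteq\mathbb{Q}$, $A-B=\{a-b:a\in A,\ b\in B\}$ and $A^2:=\{a^2:a\in A\}$ is the set of pointwise squares (not the product set). Upper Banach density is taken in the discrete amenable group $(\mathbb{Q}^d,+)$ (here $d=1$): for $E\subseteq\mathbb{Q}^d$, $$d^\star(E):=\sup_{(F_n)}\limsup_{n\to\infty}\frac{|E\cap F_n|}{|F_n|},$$ the supremum being over all Følner sequences $(F_n)$ in $\mathbb{Q}^d$, i.e. sequences of nonempty finite sets with $|(g+F_n)\triangle F_n|/|F_n|\to0$ for every $g\in\mathbb{Q}^d$. *)

(* Defs.v *)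
From HB Require Import structures.
From mathcomp Require Import all_boot all_order all_algebra finmap.
From mathcomp Require Import all_classical all_reals all_analysis.

Set Implicit Arguments.
Unset Strict Implicit.
Unset Printing Implicit Defensive.

Import Order.TTheory GRing.Theory Num.Theory.
Import numFieldNormedType.Exports.

Local Open Scope classical_set_scope.
Local Open Scope ring_scope.

Definition diffset (G : zmodType) (A B : set G) : set G :=
  [set a - b | a in A & b in B].

(* Pointwise squares, not the product set. *)
Definition sqset (K : pzRingType) (A : set K) : set K :=
  [set a ^+ 2 | a in A].

Section BanachDensity.
Variables (R : realType) (G : zmodType).

Definition translate (g : G) (F : {fset G}) : {fset G} :=
  [fset (g + x)%R | x in F]%fset.

Definition symdiff (A B : {fset G}) : {fset G} :=
  ((A `\` B) `|` (B `\` A))%fset.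

Definition folner (F : nat -> {fset G}) : Prop :=
  (forall n, F n != fset0) /\
  (forall g : G,
     (fun n => (#|` symdiff (translate g (F n)) (F n)|)%:R / (#|` F n|)%:R : R)
       @ \oo --> (0 : R)).

Definition rel_density (E : set G) (F : {fset G}) : R :=
  (#|` [fset x in F | x \in E]%fset|)%:R / (#|` F|)%:R.

Definition upper_banach_density (E : set G) : \bar R :=
  ereal_sup [set limn_esup (fun n => (rel_density E (F n))%:E)
            | F in [set F : nat -> {fset G} | folner F]].

End BanachDensity.

(* Main.v *)
Require Import Defs.
From mathcomp Require Import all_boot all_order all_algebra finmap.
From mathcomp Require Import all_classical all_reals all_analysis.
From mathcomp Require Import ring lra.

(** The equation [(a - a')^2 - (b - b')^2 = q] asks for a difference of two
    points of the product of [E1] and [E2] on a hyperbola; after a rotation the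
    hyperbola is [x * y = q].  Let [rho] be a translation-invariant mean on the
    rational plane that gives the product set [E] a positive mass [d], and let
    [phi p] be the mean of the intersection of [E] with its translate by [p].
    It suffices that [phi] does not vanish identically on the hyperbola.

    The hyperbolas are the orbits of the dilations [(x, y) -> (c x, y / c)].
    The group of these dilations is amenable, so [phi] may be averaged over it;
    it stays positive definite, [phi - d ^ 2] included, and now
    [phi (x, y) = f (x * y)] for a function [f] on the rationals.  Let [m] be the
    mean of [f] for a mean [M] on the rationals that is invariant under all
    affine maps.  Then [m >= d ^ 2 > 0], and [phi - m] is positive definite
    ([pos_def_mean]).  The heart of the proof ([pos_def_const]) is that [f q = m]
    for every [q != 0]: a positive definite function on the rational plane that
    is constant on hyperbolas is constant off the axes.

    Two applications of Bessel's inequality give this.  The points [(t, q / t)]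
    all have correlation [f q - m] with the origin, and two of them have
    correlation [G r - m] with each other, where [r] is the ratio of the
    parameters and [G r = f (- q * (r - 2 + r^-1))].  If [G] has mean [m], many
    such points can be chosen almost orthogonal, which forces [f q = m].
    To see that [G] has mean [m] ([has_mean_G]), write [G (l * r)] as the
    correlation of the origin with the point
    [(l ^ 2 * r - 2 * l + r^-1, - q / l)]: differences of these points for
    distinct [l] are affine in [r], so the points are orthogonal on average over
    [r], while their correlation with the origin has a mean independent of [l].

    The means come from ultrafilter limits of finite averages: along a Folner
    sequence for [rho] ([density_mean]), and along products of averages over
    powers for the multiplicative group ([exists_invariant_mean]). *)

Set Implicit Arguments.
Unset Strict Implicit.
Unset Printing Implicit Defensive.

Import Order.TTheory GRing.Theory Num.Theory.
Import numFieldNormedType.Exports.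

Local Open Scope classical_set_scope.
Local Open Scope ring_scope.

(** * Means on bounded functions *)

Section Bounded.
Context {R : realType} {T : Type}.
Implicit Types (h g : T -> R).

Definition bdd h := exists B : R, forall x, `|h x| <= B.

Lemma bdd_cst (c : R) : bdd (fun=> c).
Proof. by exists `|c|. Qed.

Lemma bdd_add h g : bdd h -> bdd g -> bdd (fun x => h x + g x).
Proof.
move=> [B hB] [C gC]; exists (B + C) => x.
by rewrite (le_trans (ler_normD _ _)) // lerD.
Qed.

Lemma bdd_scale (c : R) h : bdd h -> bdd (fun x => c * h x).
Proof.
by move=> [B hB]; exists (`|c| * B) => x; rewrite normrM ler_wpM2l.
Qed.

Lemma bdd_unit h : (forall x, 0 <= h x <= 1) -> bdd h.
Proof. by move=> h01; exists 1 => x; have /andP[? ?] := h01 x; rewrite ger0_norm. Qed.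

End Bounded.

(** A finitely additive probability concentrated on [D]: only the values on [D]
    are compared in the positivity clause.  The functional is total, and its
    values off the bounded functions are arbitrary. *)
Record is_mean (R : realType) (T : Type) (D : set T) (M : (T -> R) -> R) : Prop :=
  IsMean {
    mean_add : forall h g, bdd h -> bdd g -> M (fun x => h x + g x) = M h + M g;
    mean_scale : forall c h, bdd h -> M (fun x => c * h x) = c * M h;
    mean_ge : forall C h, bdd h -> (forall x, D x -> C <= h x) -> C <= M h }.

(** Carrying boundedness along with the value lets the mean of a compound
    expression be computed term by term from the shape of the expression. *)
Definition has_mean (R : realType) (T : Type) (M : (T -> R) -> R) h v :=
  bdd h /\ M h = v.

Section Mean.
Context {R : realType} {T : Type} {D : set T} {M : (T -> R) -> R}.
Hypothesis MM : is_mean D M.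

Lemma mean_le C h : bdd h -> (forall x, D x -> h x <= C) -> M h <= C.
Proof.
move=> hb hC; rewrite -lerN2.
have <- : M (fun x => -1 * h x) = - M h by rewrite (mean_scale MM) // mulN1r.
apply: (mean_ge MM) => [|x Dx]; first exact: bdd_scale.
by rewrite mulN1r lerN2 hC.
Qed.

Lemma mean_cst c : M (fun=> c) = c.
Proof.
apply/eqP; rewrite eq_le mean_le => [|//|//]; last exact: bdd_cst.
by apply: (mean_ge MM) => //; exact: bdd_cst.
Qed.

Lemma mean_norm_le B h : (forall x, `|h x| <= B) -> `|M h| <= B.
Proof.
move=> hB; have hb : bdd h by exists B.
rewrite ler_norml mean_le ?andbT => [|//|x _].
  by apply: (mean_ge MM) => // x _; have := hB x; rewrite ler_norml => /andP[].
by have := hB x; rewrite ler_norml => /andP[].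
Qed.

Lemma mean_unit h : (forall x, 0 <= h x <= 1) -> 0 <= M h <= 1.
Proof.
move=> h01; have hb := bdd_unit h01.
apply/andP; split; [apply: (mean_ge MM) => // x _|apply: mean_le => // x _].
  by have /andP[] := h01 x.
by have /andP[] := h01 x.
Qed.

Lemma eq_mean h g : bdd h -> bdd g -> (forall x, D x -> h x = g x) -> M h = M g.
Proof.
move=> hb gb hg; pose d x := h x + -1 * g x.
have db : bdd d by apply: bdd_add => //; exact: bdd_scale.
have Md : M d = M h - M g.
  rewrite [LHS](mean_add MM) //; last exact: bdd_scale.
  by rewrite (mean_scale MM) // mulN1r.
apply/eqP; rewrite -subr_eq0 -Md eq_le.
by rewrite mean_le ?(mean_ge MM) // => x Dx; rewrite /d hg // mulN1r subrr.
Qed.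

Lemma has_mean_self h : bdd h -> has_mean M h (M h).
Proof. by []. Qed.

Lemma has_mean_cst c : has_mean M (fun=> c) c.
Proof. by split; [exact: bdd_cst|exact: mean_cst]. Qed.

Lemma has_mean_add h g a b :
  has_mean M h a -> has_mean M g b -> has_mean M (fun x => h x + g x) (a + b).
Proof. by move=> [? <-] [? <-]; split; [exact: bdd_add|exact: (mean_add MM)]. Qed.

Lemma has_mean_scale c h a : has_mean M h a -> has_mean M (fun x => c * h x) (c * a).
Proof. by move=> [? <-]; split; [exact: bdd_scale|exact: (mean_scale MM)]. Qed.

Lemma has_mean_sum (I : eqType) (s : seq I) (h : I -> T -> R) (a : I -> R) :
  (forall i, i \in s -> has_mean M (h i) (a i)) ->
  has_mean M (fun x => \sum_(i <- s) h i x) (\sum_(i <- s) a i).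
Proof.
elim: s => [_|i s IH ha].
  rewrite big_nil (_ : (fun _ => _) = fun=> 0) ?funeqE => [|x]; last by rewrite big_nil.
  exact: has_mean_cst.
rewrite big_cons (_ : (fun _ => _) = fun x => h i x + \sum_(j <- s) h j x).
  apply: has_mean_add; first by apply: ha; rewrite mem_head.
  by apply: IH => j js; apply: ha; rewrite inE js orbT.
by rewrite funeqE => x; rewrite big_cons.
Qed.

Lemma has_mean_ge C h a : has_mean M h a -> (forall x, D x -> C <= h x) -> C <= a.
Proof. by move=> [hb <-]; exact: (mean_ge MM). Qed.

Lemma has_mean_le C h a : has_mean M h a -> (forall x, D x -> h x <= C) -> a <= C.
Proof. by move=> [hb <-]; exact: mean_le. Qed.

End Mean.

Lemma eq_has_mean (R : realType) (T : Type) (M : (T -> R) -> R) h g a :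
  (forall x, h x = g x) -> has_mean M h a -> has_mean M g a.
Proof. by move=> hg; rewrite (_ : h = g) // funeqE. Qed.

(** The averaging arguments below all end with an error of relative size
    [1/N]; this disposes of it. *)
Lemma archimedean_le0 (R : realType) (a c : R) :
  (forall N : nat, N%:R * a <= c) -> a <= 0.
Proof.
move=> H; rewrite leNgt; apply/negP => a0.
have c0 : 0 <= c by have := H 0%N; rewrite mul0r.
have := archi_boundP (divr_ge0 c0 (ltW a0)).
by rewrite ltr_pdivrMr // ltNge H.
Qed.

Record affine_mean (R : realType) (M : (rat -> R) -> R) : Prop := AffineMean {
  affine_is_mean : is_mean setT M;
  affine_invariant : forall a b h, a != 0 -> bdd h ->
    M (fun x => h (a * x + b)) = M h }.

Section AffineMean.
Context {R : realType} {M : (rat -> R) -> R}.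
Hypothesis MA : affine_mean M.
Let MM := affine_is_mean MA.

Lemma has_mean_affine a b h v :
  a != 0 -> has_mean M h v -> has_mean M (fun x => h (a * x + b)) v.
Proof.
move=> a0 [hb hv]; split; last by rewrite affine_invariant.
by have [B hB] := hb; exists B.
Qed.

(** Points are null: the translates of the indicator of a point all have the
    same mean, and the sum of [N] of them is at most [1]. *)
Lemma mean_point (y : rat) : has_mean M (fun x => (x == y)%:R) 0.
Proof.
have b01 : bdd (fun x : rat => (x == y)%:R : R).
  by apply: bdd_unit => x; case: (x == y); rewrite ?ler01 ?lexx.
split => //; set e := M _.
have he : has_mean M (fun x : rat => (x == y)%:R) e by [].
apply/eqP; rewrite eq_le; apply/andP; split; last first.
  by apply: (has_mean_ge MM he) => x _; case: (x == y).
apply: (@archimedean_le0 _ e 1) => N.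
have hs : has_mean M (fun x => \sum_(k <- iota 0 N) (1 * x + - k%:R == y)%:R)
    (\sum_(k <- iota 0 N) e).
  by apply: (has_mean_sum MM) => k _; exact: (has_mean_affine _ _ he).
rewrite big_const_seq count_predT size_iota iter_addr_0 in hs.
rewrite mulr_natl; apply: (has_mean_le MM hs) => x _.
rewrite -natr_sum lern1.
set p := fun k : nat => 1 * x - k%:R == y.
have -> : (\sum_(k <- iota 0 N) p k = count p (iota 0 N))%N.
  by rewrite -sum1_count [RHS]big_mkcond; apply: eq_bigr => k _; rewrite /p; case: eqP.
have [/hasP[k _ pk]|] := boolP (has p (iota 0 N)); last first.
  by rewrite has_count -leqNgt => /leq_trans ->.
apply: leq_trans (_ : count (pred1 k) (iota 0 N) <= 1)%N.
  apply: sub_count => l /eqP pl /=; move/eqP: pk; rewrite -pl => /addrI /oppr_inj /eqP.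
  by rewrite eqr_nat eq_sym.
by rewrite count_uniq_mem ?iota_uniq // leq_b1.
Qed.

(** Adding a large multiple of the indicator of [s], which has mean [0], makes
    the inequality hold everywhere. *)
Lemma has_mean_ge_cofinite (s : seq rat) C h a :
  has_mean M h a -> (forall x, x \notin s -> C <= h x) -> C <= a.
Proof.
move=> ha hC; have [[B hB] _] := ha.
pose K := `|C| + B.
have hs := has_mean_add MM ha (has_mean_scale MM K
  (has_mean_sum MM (s := s) (fun y _ => mean_point y))).
rewrite big1 // mulr0 addr0 in hs.
apply: (has_mean_ge MM hs) => x _.
have K0 : 0 <= K by rewrite addr_ge0 // (le_trans _ (hB 0)).
have [xs|xs] := boolP (x \in s); last first.
  by rewrite (le_trans (hC _ xs)) // lerDl mulr_ge0 // sumr_ge0.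
have : (1 : R) <= \sum_(y <- s) (x == y)%:R.
  by rewrite (big_rem x) //= eqxx lerDl sumr_ge0.
move=> /(ler_wpM2l K0); rewrite mulr1 => /(lerD (lexx (h x))); apply: le_trans.
have := hB x; rewrite ler_norml => /andP[? _].
by rewrite /K; have := ler_norm C; lra.
Qed.

End AffineMean.

(** * Ultrafilter limits *)

Section UltraLimit.
Context {R : realType} {U : set_system nat}.
Hypothesis UU : UltraFilter U.

(** The sequence stays in a compact interval, so its image under [U] has a
    cluster point, and a cluster point of an ultrafilter is a limit. *)
Lemma ultra_cvg (u : nat -> R) : bdd u -> cvg (u n @[n --> U]).
Proof.
move=> [B uB].
have cpt := @segment_compact R (- B) B.
have FU : ProperFilter (u n @[n --> U]) by apply: fmap_proper_filter.
have : (u n @[n --> U]) `[- B, B]%classic.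
  have : U (u @^-1` `[- B, B]) by apply: filterE => n /=; rewrite in_itv /= -ler_norml.
  by [].
move=> /(cpt _ FU) [p [_ clp]].
apply/cvg_ex; exists p => V Vp.
have [//|UV] := in_ultra_setVsetC (u @^-1` V) UU.
by have [x [nVx Vx]] := clp (~` V) V UV Vp.
Qed.

Definition ultra_lim (u : nat -> R) : R := lim (u n @[n --> U]).

Lemma ultra_limP (u : nat -> R) : bdd u -> u n @[n --> U] --> ultra_lim u.
Proof. exact: ultra_cvg. Qed.

Lemma ultra_lim_mean (T : Type) (D : set T) (mu : nat -> (T -> R) -> R) :
  (forall n, is_mean D (mu n)) -> is_mean D (fun h => ultra_lim (fun n => mu n h)).
Proof.
move=> muM.
have b (h : T -> R) : bdd h -> bdd (fun n => mu n h).
  by move=> [B hB]; exists B => n; exact: (mean_norm_le (muM n)).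
have UF : ProperFilter U by exact: ultra_proper.
split=> [h g hb gb|c h hb|C h hb hC].
- apply/cvg_lim => //.
  under eq_fun do rewrite (mean_add (muM _)) //.
  by apply: cvgD; apply: ultra_limP; exact: b.
- apply/cvg_lim => //.
  under eq_fun do rewrite (mean_scale (muM _)) //.
  by apply: cvgMr; apply: ultra_limP; exact: b.
- apply: limr_ge; first by apply: ultra_cvg; exact: b.
  by apply: filterE => n; exact: (mean_ge (muM n)).
Qed.

Lemma eq_ultra_lim (u v e : nat -> R) : \oo `<=` U -> bdd u -> bdd v ->
  (forall n, `|u n - v n| <= e n) -> e n @[n --> \oo] --> (0 : R) ->
  ultra_lim u = ultra_lim v.
Proof.
move=> ooU ub vb uve e0.
have UF : ProperFilter U by exact: ultra_proper.
apply/eqP; rewrite -subr_eq0; apply/eqP.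
have c : (u n - v n) @[n --> U] --> ultra_lim u - ultra_lim v.
  by apply: cvgB; exact: ultra_limP.
rewrite -(cvg_lim _ c) //.
apply/cvg_lim => //; apply: norm_cvg0.
apply: (@squeeze_cvgr _ _ _ _ (fun=> 0) e); first by near=> n; rewrite normr_ge0 uve.
  exact: cvg_cst.
apply: cvg_trans e0; exact: cvg_app.
Unshelve. all: end_near. Qed.

End UltraLimit.

(** * Translation-invariant means from upper Banach density *)

Section FinsetSums.
Context {R : realType} {T : choiceType}.
Implicit Types (A B : {fset T}) (h : T -> R).

Lemma average_mean (s : seq T) : (0 < size s)%N ->
  is_mean setT (fun h : T -> R => (\sum_(x <- s) h x) / (size s)%:R).
Proof.
move=> s0; have n0 : (0 : R) < (size s)%:R by rewrite ltr0n.
split=> [h g _ _|c h _|C h _ hC].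
- by rewrite big_split mulrDl.
- by rewrite -mulr_sumr mulrA.
- rewrite ler_pdivlMr //.
  have -> : C * (size s)%:R = \sum_(x <- s) C.
    by rewrite big_const_seq count_predT iter_addr_0 mulr_natr.
  by apply: ler_sum => x _; exact: hC.
Qed.

Lemma norm_sum_fset A h b : (forall x, `|h x| <= b) ->
  `|\sum_(x <- A) h x| <= b * (#|` A|)%:R.
Proof.
move=> hb; apply: le_trans (ler_norm_sum _ _ _) _.
apply: le_trans (ler_sum _ (fun x _ => hb x)) _.
by rewrite big_const_seq count_predT iter_addr_0 mulr_natr.
Qed.

Lemma sum_fsetID A B h :
  \sum_(x <- A) h x =
  \sum_(x <- (A `&` B)%fset) h x + \sum_(x <- (A `\` B)%fset) h x.
Proof.
rewrite (big_fsetID _ (mem B)) /=; congr (_ + _).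
  by apply: eq_fbigl => x; rewrite !inE.
by apply: eq_fbigl => x; rewrite !inE andbC.
Qed.

Lemma sum_fset_symdiff (A B : {fset T}) h b : (forall x, `|h x| <= b) ->
  `|\sum_(x <- A) h x - \sum_(x <- B) h x| <=
    b * (#|` ((A `\` B) `|` (B `\` A))%fset|)%:R.
Proof.
move=> hb; rewrite cardfsU [X in (_ + _ - X)%N](_ : _ = 0%N) ?subn0; last first.
  apply/eqP; rewrite cardfs_eq0; apply/eqP/fsetP => x; rewrite !inE.
  by case: (x \in A); rewrite ?andbF.
rewrite natrD mulrDr (sum_fsetID A B) (sum_fsetID B A) fsetIC opprD addrACA subrr add0r.
by apply: le_trans (ler_normB _ _) _; apply: lerD; exact: norm_sum_fset.
Qed.
End FinsetSums.

Lemma sum_translate (R : realType) (G : zmodType) (g : G) (F : {fset G}) (h : G -> R) :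
  \sum_(x <- translate g F) h x = \sum_(x <- F) h (g + x).
Proof. by rewrite big_imfset //= => x y _ _ /addrI. Qed.

Section FolnerMean.
Context {R : realType} {G : zmodType}.

Lemma upper_banach_density_frequently (E : set G) :
  (0 < upper_banach_density R E)%E ->
  exists F : nat -> {fset G}, folner R F /\
  exists2 d : R, 0 < d & forall N, exists2 n, (N <= n)%N & d <= rel_density R E (F n).
Proof.
move=> /ereal_sup_gt [_ [F FF <-]] pos; exists F; split => //.
move: pos; set l := limn_esup _ => pos.
have [d d0 dl] : exists2 d : R, 0 < d & (d%:E < l)%E.
  case: l pos => [r| |] //.
    by rewrite lte_fin => r0; exists (r / 2); rewrite ?lte_fin; lra.
  by move=> _; exists 1; rewrite ?ltry.
exists d => // N; apply: contrapT => noN.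
move: dl; rewrite ltNge => /negP; apply.
rewrite /l /limn_esup /limf_esup.
apply: le_trans (_ : ereal_sup ((fun n => (rel_density R E (F n))%:E) @`
    [set n | (N <= n)%N]) <= _)%E.
  apply: ereal_inf_lbound; exists [set n | (N <= n)%N] => //.
  exact: nbhs_infty_ge.
apply: ge_ereal_sup => _ [n /= Nn <-]; rewrite lee_fin leNgt; apply/negP => dn.
by apply: noN; exists n => //; exact: ltW.
Qed.

(** Ultrafilter limit of the averages over a Folner sequence; the ultrafilter
    contains the infinite set of indices where [E] has relative density at
    least [d], which keeps the mean of [E] away from [0]. *)
Lemma density_mean (E : set G) : (0 < upper_banach_density R E)%E ->
  exists rho : (G -> R) -> R, [/\ is_mean setT rho,
    (forall g h, bdd h -> rho (fun x => h (g + x)) = rho h) &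
    0 < rho (fun x => (x \in E)%:R)].
Proof.
move=> /upper_banach_density_frequently [F [[F0 Finv] [d d0 often]]].
pose V : set_system nat := within [set n | d <= rel_density R E (F n)] \oo.
have VF : ProperFilter V.
  apply: Build_ProperFilter_ex.
  move=> A [N _ NA]; have [n Nn dn] := often N.
  by exists n; apply: NA.
have [U [UU VU]] := ultraFilterLemma VF.
have UF : ProperFilter U := ultra_proper.
pose mu n (h : G -> R) := (\sum_(x <- F n) h x) / (size (F n))%:R.
have muM n : is_mean setT (mu n).
  by apply: average_mean; rewrite lt0n cardfs_eq0.
have mub h : bdd h -> bdd (mu^~ h).
  by move=> [B hB]; exists B => n; exact: (mean_norm_le (muM n)).
have ooU : \oo `<=` U.
  by apply: subset_trans VU; exact: cvg_within.
exists (fun h => @ultra_lim R U (mu^~ h)); split.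
- exact: ultra_lim_mean.
- move=> g h hb; have [B hB] := hb.
  have gb : bdd (fun x => h (g + x)) by exists B.
  apply: (eq_ultra_lim UU ooU (mub _ gb) (mub _ hb)
    (e := fun n => B * ((#|` symdiff (translate g (F n)) (F n)|)%:R / (#|` F n|)%:R))).
    move=> n; rewrite /mu -mulrBl normrM mulrA [X in _ * X <= _]ger0_norm ?invr_ge0 //.
    apply: ler_wpM2r; first by rewrite invr_ge0.
    by rewrite -sum_translate; exact: sum_fset_symdiff.
  by rewrite -[0](mulr0 B); apply: cvgMr; exact: Finv.
- apply: lt_le_trans d0 _.
  apply: limr_ge.
    apply: (ultra_cvg UU); apply: mub; apply: bdd_unit => x.
    by case: (x \in E); rewrite ?lexx ?ler01.
  have : U [set n | d <= rel_density R E (F n)] by apply: VU; exact: withinT.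
  apply: filterS => n /=; congr (_ <= _); congr (_ / _).
  rewrite (big_fsetID _ (fun x => x \in E)) /= [X in _ + X]big_seq_cond.
  rewrite [X in _ = _ + X]big1 ?addr0 => [|x]; last first.
    by rewrite !inE andbT => /andP[_ /negbTE ->].
  rewrite big_seq (eq_bigr (fun=> 1)) -?big_seq => [|x].
    by rewrite big_const_seq count_predT iter_addr_0.
  by rewrite !inE => /andP[_ ->].
Qed.
End FolnerMean.

(** * Invariant means for commuting maps *)

Section CommutingMaps.
Context {R : realType} {T : Type} {D : set T} {phi : nat -> T -> T} {x0 : T}.
Hypothesis Dx0 : D x0.
Hypothesis Dphi : forall i x, D x -> D (phi i x).
Hypothesis phiC : forall i j x, phi i (phi j x) = phi j (phi i x).

Definition orbit_average n i (h : T -> R) x : R :=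
  (\sum_(0 <= k < n.+1) h (iter k (phi i) x)) / n.+1%:R.

Definition orbit_averages n (l : seq nat) (h : T -> R) : T -> R :=
  foldr (orbit_average n) h l.

Let Diter i k x : D x -> D (iter k (phi i) x).
Proof. by move=> Dx; elim: k => //= k; exact: Dphi. Qed.

Lemma orbit_averages_mean n l x : D x -> is_mean D (fun h => orbit_averages n l h x).
Proof.
elim: l x => [|i l IH] x Dx.
  by split=> // C h _; apply.
have M k := IH _ (Diter i k Dx).
split=> [h g hb gb|c h hb|C h hb hC] /=; rewrite /orbit_average.
- rewrite -mulrDl -big_split /=; congr (_ / _); apply: eq_bigr => k _.
  exact: (mean_add (M k)).
- rewrite mulrA mulr_sumr; congr (_ / _); apply: eq_bigr => k _.
  exact: (mean_scale (M k)).
- rewrite ler_pdivlMr ?ltr0n //.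
  have -> : C * n.+1%:R = \sum_(0 <= k < n.+1) C.
    by rewrite big_const_nat subn0 iter_addr_0 mulr_natr.
  by apply: ler_sum => k _; exact: (mean_ge (M k)).
Qed.

Lemma orbit_averages_comp n l j h x :
  orbit_averages n l (fun x => h (phi j x)) x = orbit_averages n l h (phi j x).
Proof.
elim: l x => //= i l IH x; rewrite /orbit_average; congr (_ / _).
apply: eq_bigr => k _; rewrite IH; congr (orbit_averages _ _ _ _).
by elim: k => //= k IHk; rewrite phiC IHk.
Qed.

(** By commutation the average along [phi j] can be applied to the difference
    directly, where it telescopes. *)
Lemma orbit_averages_diff n l j h x B : D x -> (forall x, `|h x| <= B) -> j \in l ->
  `|orbit_averages n l (fun x => h (phi j x)) x - orbit_averages n l h x|
    <= 2 * B / n.+1%:R.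
Proof.
move=> Dx hB; elim: l x Dx => // i l IH x Dx.
rewrite inE; have [<- _|ji /= jl] := eqVneq j i.
  rewrite orbit_averages_comp /= /orbit_average -mulrBl -sumrB.
  under eq_bigr do rewrite -iterSr.
  rewrite (telescope_sumr (fun k => orbit_averages n l h (iter k (phi j) x))) //=.
  rewrite normrM [X in _ * X <= _]ger0_norm ?invr_ge0 // ler_wpM2r ?invr_ge0 //.
  rewrite (le_trans (ler_normB _ _)) // mulr_natl mulr2n.
  by apply: lerD; apply: (mean_norm_le (orbit_averages_mean n l _)) => //;
    exact: (@Diter _ n.+1).
rewrite /orbit_average -mulrBl -sumrB.
rewrite normrM [X in _ * X <= _]ger0_norm ?invr_ge0 // ler_pdivrMr ?ltr0n //.
have -> : 2 * B / n.+1%:R * n.+1%:R = \sum_(0 <= k < n.+1) (2 * B / n.+1%:R).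
  by rewrite big_const_nat subn0 iter_addr_0 mulr_natr.
apply: (le_trans (ler_norm_sum _ _ _)); apply: ler_sum => k _.
by apply: IH => //; exact: Diter.
Qed.

(** The Markov-Kakutani theorem for countably many commuting maps: at stage [n]
    one averages over [n.+1] steps along each of the first [n] maps. *)
Lemma exists_invariant_mean : exists N : (T -> R) -> R,
  is_mean D N /\ forall i h, bdd h -> N (fun x => h (phi i x)) = N h.
Proof.
have [U [UU ooU]] := ultraFilterLemma eventually_filter.
pose mu n (h : T -> R) := orbit_averages n (iota 0 n) h x0.
have muM n : is_mean D (mu n) by exact: orbit_averages_mean.
have mub h : bdd h -> bdd (mu^~ h).
  by move=> [B hB]; exists B => n; exact: (mean_norm_le (muM n)).
exists (fun h => @ultra_lim R U (mu^~ h)); split; first exact: ultra_lim_mean.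
move=> i h hb; have [B hB] := hb.
have gb : bdd (fun x => h (phi i x)) by exists B.
have B0 : 0 <= B by rewrite (le_trans _ (hB x0)).
(* The map [phi i] enters the averages at stage [i.+1]; the factor [i.+1] makes
   the bound trivial before that stage. *)
apply: (eq_ultra_lim UU ooU (mub _ gb) (mub _ hb)
  (e := fun n => i.+1%:R * (2 * B) * harmonic n)).
  move=> n; rewrite /harmonic /= ler_pdivlMr ?ltr0n //.
  have [ni|ni] := leqP n i.
    apply: (@le_trans _ _ ((2 * B) * n.+1%:R)).
      rewrite ler_wpM2r // (le_trans (ler_normB _ _)) // mulr_natl mulr2n.
      by apply: lerD; apply: (mean_norm_le (muM n)).
    by rewrite mulrC ler_wpM2r ?mulr_ge0 // ler_nat ltnS.
  have := @orbit_averages_diff n (iota 0 n) i h x0 B Dx0 hB.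
  rewrite mem_iota => /(_ ni); rewrite ler_pdivlMr ?ltr0n // => /le_trans; apply.
  by rewrite ler_peMl ?mulr_ge0 // ler1n.
by rewrite -[0](mulr0 (i.+1%:R * (2 * B))); apply: cvgMr; exact: cvg_harmonic.
Qed.

End CommutingMaps.

(** An invariant mean on the multiplicative group of the rationals, from an
    enumeration of its elements. *)
Lemma exists_dilation_mean (R : realType) : exists N : (rat -> R) -> R,
  is_mean [set c | c != 0] N /\
  forall a h, a != 0 -> bdd h -> N (fun c => h (a * c)) = N h.
Proof.
pose a (i : nat) : rat :=
  if @choice.unpickle rat i is Some c then if c == 0 then 1 else c else 1.
have a0 i : a i != 0.
  rewrite /a; case: choice.unpickle => [c|]; last exact: oner_neq0.
  by case: (eqVneq c 0) => // _; exact: oner_neq0.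
have stable i x : x != 0 -> a i * x != 0 by move=> x0; rewrite mulf_neq0.
have [N [NM Ninv]] := @exists_invariant_mean R rat [set c | c != 0]
  (fun i x => a i * x) 1 (oner_neq0 _) stable (fun i j x => mulrCA _ _ _).
exists N; split => // c h c0 hb; rewrite -(Ninv (choice.pickle c) h) //.
by rewrite /a choice.pickleK (negbTE c0).
Qed.

(** * Affine-invariant means *)

Section Composition.
Context {R : realType}.

Lemma bdd_mean (S T : Type) (D : set T) (M : (T -> R) -> R) (h : S -> T -> R) :
  is_mean D M -> (exists B : R, forall x y, `|h x y| <= B) -> bdd (fun x => M (h x)).
Proof. by move=> MM [B hB]; exists B => x; exact: (mean_norm_le MM). Qed.

Lemma iterated_mean (S T W : Type) (D : set S) (E : set T) (u : S -> T -> W)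
    (A : set W) (N : (S -> R) -> R) (M : (T -> R) -> R) :
  is_mean D N -> is_mean E M -> (forall x y, D x -> E y -> A (u x y)) ->
  is_mean A (fun h : W -> R => N (fun x => M (fun y => h (u x y)))).
Proof.
move=> NM MM uA.
have b (h : W -> R) : bdd h -> bdd (fun x => M (fun y => h (u x y))).
  by move=> [B hB]; apply: (bdd_mean MM); exists B.
have b1 (h : W -> R) x : bdd h -> bdd (fun y => h (u x y)).
  by move=> [B hB]; exists B.
split=> [h g hb gb|c h hb|C h hb hC].
- rewrite -(mean_add NM (b _ hb) (b _ gb)); congr N; apply/funext => x.
  by rewrite (mean_add MM); [|exact: b1|exact: b1].
- rewrite -(mean_scale NM _ (b _ hb)); congr N; apply/funext => x.
  by rewrite (mean_scale MM); last exact: b1.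
- apply: (mean_ge NM) => [|x Dx]; first exact: b.
  by apply: (mean_ge MM) => [|y Ey]; [exact: b1|exact/hC/uA].
Qed.

(** A translation-invariant mean need not be dilation-invariant; averaging its
    dilates over the multiplicative group repairs this, and the dilates remain
    translation-invariant. *)
Lemma affine_mean_of (N M : (rat -> R) -> R) :
  is_mean [set c | c != 0] N ->
  (forall a h, a != 0 -> bdd h -> N (fun c => h (a * c)) = N h) ->
  is_mean setT M ->
  (forall g h, bdd h -> M (fun x => h (g + x)) = M h) ->
  affine_mean (fun h : rat -> R => N (fun c => M (fun x => h (c * x)))).
Proof.
move=> NM Ninv MM Minv; split; first exact: (iterated_mean NM MM).
move=> a b h a0 hb; have [B hB] := hb.
have bb c : bdd (fun x => h (c * x)) by exists B.
rewrite -(Ninv a (fun c => M (fun x => h (c * x))) a0); last by apply: (bdd_mean MM); exists B.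
apply: (eq_mean NM); [by apply: (bdd_mean MM); exists B|by apply: (bdd_mean MM); exists B|].
move=> c /= c0; rewrite -(Minv (b / (a * c)) (fun x => h (a * c * x))) //.
congr M; apply/funext => x; congr h; field.
by rewrite a0 c0.
Qed.

End Composition.

(** * Positive definite functions constant on hyperbolas *)

(** Positive definiteness with a mass of at least [c0] at the trivial character:
    [phi - c0] is positive definite. *)
Definition pos_def (R : realType) (phi : rat -> rat -> R) (c0 : R) :=
  forall (I : eqType) (s : seq I) (w : I -> R) (x y : I -> rat),
    c0 * (\sum_(i <- s) w i) ^+ 2 <=
    \sum_(i <- s) \sum_(j <- s) w i * w j * phi (x i - x j) (y i - y j).

Section Hyperbola.
Context {R : realType} {M : (rat -> R) -> R} {phi : rat -> rat -> R}.
Hypothesis MA : affine_mean M.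
Hypothesis phi01 : forall x y, 0 <= phi x y <= 1.
Hypothesis phi_dil : forall c x y, c != 0 -> phi (c * x) (y / c) = phi x y.

Let MM := affine_is_mean MA.
Let f s := phi s 1.
Let m := M f.

Lemma phi_hyperbola x y : y != 0 -> phi x y = f (x * y).
Proof.
by move=> y0; rewrite -(phi_dil x y y0) divff // mulrC.
Qed.

Lemma phi_opp x y : phi (- x) (- y) = phi x y.
Proof.
have n1 : -1 != 0 :> rat by rewrite oppr_eq0 oner_eq0.
by rewrite -(phi_dil x y n1) mulN1r invrN invr1 mulrN1.
Qed.

Lemma has_mean_line a b y : a != 0 -> y != 0 -> has_mean M (fun x => phi (a * x + b) y) m.
Proof.
move=> a0 y0; apply: (@eq_has_mean _ _ _ (fun x => f ((y * a) * x + (y * b)))).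
  by move=> x; rewrite phi_hyperbola // -mulrA -mulrDr mulrC.
apply: (has_mean_affine MA); first by rewrite mulf_neq0.
by split => //; apply: bdd_unit => x; exact: phi01.
Qed.

Let m_ge0 : 0 <= m.
Proof. by have /andP[] := mean_unit MM (fun x => phi01 x 1). Qed.

(** The correlations of the points [(k.+1 * r, Y k)], averaged over [r]: the
    difference of two distinct points runs along a line on which [phi] has mean
    [m]. *)
Lemma has_mean_grid N (Y : nat -> rat) :
  injective Y ->
  exists2 v, has_mean M (fun r => \sum_(k <- iota 0 N) \sum_(l <- iota 0 N)
     phi (k.+1%:R * r - l.+1%:R * r) (Y k - Y l)) v & v <= N%:R * (N%:R * m + 1).
Proof.
move=> Yinj.
exists (\sum_(k <- iota 0 N) \sum_(l <- iota 0 N) (if k == l then phi 0 0 else m)).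
  apply: (has_mean_sum MM) => k _; apply: (has_mean_sum MM) => l _.
  case: eqP => [->|/eqP kl].
    apply: (@eq_has_mean _ _ _ (fun=> phi 0 0)) => [r|]; last exact: (has_mean_cst MM).
    by rewrite !subrr.
  apply: (@eq_has_mean _ _ _ (fun r => phi ((k.+1%:R - l.+1%:R) * r + 0) (Y k - Y l))).
    by move=> r; rewrite addr0 mulrBl.
  apply: has_mean_line; first by rewrite subr_eq0 eqr_nat eqSS.
  by rewrite subr_eq0 (inj_eq Yinj).
have row k : \sum_(l <- iota 0 N) (if k == l then phi 0 0 else m) <= N%:R * m + 1.
  apply: (@le_trans _ _ (\sum_(l <- iota 0 N) (m + (l == k)%:R))).
    apply: ler_sum => l _; rewrite eq_sym; case: eqP => _; last by rewrite addr0.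
    by have /andP[_ h] := phi01 0 0; rewrite (le_trans h) // lerDr.
  rewrite big_split /= big_const_seq count_predT size_iota iter_addr_0 mulr_natl lerD2l.
  rewrite -natr_sum lern1 -big_mkcond /= sum1_count count_uniq_mem ?iota_uniq //.
  exact: leq_b1.
apply: (@le_trans _ _ (\sum_(k <- iota 0 N) (N%:R * m + 1))).
  by apply: ler_sum => k _; exact: row.
by rewrite big_const_seq count_predT size_iota iter_addr_0 (mulr_natl (_ + 1)).
Qed.

(** Test positivity on the points [(k.+1 * r, k)] with equal weights. *)
Lemma pos_def_mean_ge c0 : pos_def phi c0 -> c0 <= m.
Proof.
move=> pd; rewrite -subr_le0; apply: (@archimedean_le0 _ _ 1) => -[|N].
  by rewrite mul0r.
set n := N.+1.
have [v hv vle] := @has_mean_grid n (fun k => k%:R) (mulrIn (oner_neq0 _)).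
have : c0 * n%:R ^+ 2 <= v.
  apply: (has_mean_ge MM hv) => r _.
  have := pd _ (iota 0 n) (fun=> 1) (fun k => k.+1%:R * r) (fun k => k%:R).
  rewrite big_const_seq count_predT size_iota iter_addr_0.
  by under eq_bigr do under eq_bigr do rewrite mulr1 mul1r.
move=> /le_trans /(_ vle); rewrite expr2 mulrCA ler_pM2l ?ltr0n // => h.
by rewrite mulrBr [n%:R * c0]mulrC lerBlDl.
Qed.

(** In Hilbert space terms [m] is the squared norm of the projection of the
    cyclic vector to the invariant vectors, and subtracting that projection
    leaves a positive definite function.  The projection is approximated by the
    average over [n] points [(k.+1 * r, Y + k)]; so the given points are tested
    together with these, which carry the weight [- S / n] each. *)
Lemma pos_def_mean c0 : 0 <= c0 -> pos_def phi c0 -> pos_def phi m.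
Proof.
move=> c00 pd I s w x y; set S := \sum_(i <- s) w i.
set Phi := \sum_(i <- s) \sum_(j <- s) _.
rewrite -subr_le0; apply: (@archimedean_le0 _ _ (S ^+ 2)) => -[|N].
  by rewrite mul0r sqr_ge0.
move: N.+1 (ltn0Sn N) => n n_gt0.
(* Beyond [Y] the second coordinates of the auxiliary points avoid all [y i]. *)
pose Y := 1 + \sum_(i <- s) `|y i|.
have yY i (k : nat) : i \in s -> y i - (Y + k%:R) != 0.
  move=> si; rewrite subr_eq0; apply/eqP => yi.
  have : `|y i| <= \sum_(i <- s) `|y i|.
    by rewrite (big_rem i) //= lerDl sumr_ge0.
  have := ler_norm (y i); have := ler0n rat k.
  by rewrite yi /Y; lra.
have Yinj : injective (fun k : nat => Y + k%:R).
  by move=> k l /addrI /eqP; rewrite eqr_nat => /eqP.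
have [v hv vle] := @has_mean_grid n (fun k => Y + k%:R) Yinj.
pose t : R := - S / n%:R.
pose C r := \sum_(i <- s) \sum_(k <- iota 0 n)
  w i * t * phi (x i - k.+1%:R * r) (y i - (Y + k%:R)).
have hC : has_mean M C (- (S ^+ 2 * m)).
  have -> : - (S ^+ 2 * m) = \sum_(i <- s) \sum_(k <- iota 0 n) w i * t * m.
    under eq_bigr do rewrite big_const_seq count_predT size_iota iter_addr_0 -mulr_natr -!mulrA.
    by rewrite -mulr_suml -/S /t; field; rewrite pnatr_eq0 -lt0n.
  apply: (has_mean_sum MM) => i si; apply: (has_mean_sum MM) => k _.
  apply: (has_mean_scale MM).
  apply: (@eq_has_mean _ _ _ (fun r => phi (- k.+1%:R * r + x i) (y i - (Y + k%:R)))).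
    by move=> r; rewrite addrC mulNr.
  by apply: has_mean_line; [rewrite oppr_eq0 pnatr_eq0|exact: yY].
have hQ := has_mean_add MM (has_mean_cst MM Phi)
  (has_mean_add MM (has_mean_scale MM 2 hC) (has_mean_scale MM (t ^+ 2) hv)).
have : 0 <= Phi + (2 * - (S ^+ 2 * m) + t ^+ 2 * v).
  apply: (has_mean_ge MM hQ) => r _.
  have := pd _ (map inl s ++ map inr (iota 0 n)) (fun i => if i is inl i then w i else t)
    (fun i => match i with inl i => x i | inr k => k.+1%:R * r end)
    (fun i => match i with inl i => y i | inr k => Y + k%:R end).
  rewrite !big_cat !big_map /= -/S.
  rewrite [\sum_(k <- iota 0 n) t]big_const_seq count_predT size_iota iter_addr_0.
  have -> : S + t *+ n = 0.
    by rewrite -mulr_natr /t mulfVK ?pnatr_eq0 -?lt0n // subrr.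
  rewrite expr0n /= mulr0 => /le_trans; apply.
  set Z := t ^+ 2 * _; have -> : Phi + (2 * C r + Z) = (Phi + C r) + (C r + Z) by ring.
  rewrite /Z. apply: lerD.
    rewrite le_eqVlt; apply/orP; left; apply/eqP.
    rewrite -big_split; apply: eq_bigr => i _ /=.
    by rewrite big_cat !big_map.
  rewrite le_eqVlt; apply/orP; left; apply/eqP.
  rewrite /C [\sum_(i <- s) _]exchange_big mulr_sumr -big_split /=; apply: eq_bigr => k _.
  rewrite big_cat !big_map mulr_sumr /=; congr (_ + _); apply: eq_bigr => i _.
    by rewrite -phi_opp !opprB [t * _]mulrC.
have n0 : (0 : R) < n%:R by rewrite ltr0n.
have : t ^+ 2 * v <= S ^+ 2 * m + S ^+ 2 / n%:R.
  apply: le_trans (ler_wpM2l (sqr_ge0 t) vle) _.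
  by rewrite le_eqVlt /t; apply/orP; left; apply/eqP; field; rewrite pnatr_eq0 -lt0n.
move=> h1 h2.
have : S ^+ 2 * m - Phi <= S ^+ 2 / n%:R by lra.
by rewrite ler_pdivlMr // mulrC [m * _]mulrC.
Qed.

(** Positivity of [phi - m] on the origin, with weight [z], and the points
    [(x i, y i)], with weight [1]: a Cauchy-Schwarz inequality in which [z] is
    still to be chosen. *)
Lemma pos_def_deviation (I : eqType) (s : seq I) (x y : I -> rat) (z : R) :
  pos_def phi m ->
  0 <= z ^+ 2 + 2 * z * (\sum_(i <- s) (phi (x i) (y i) - m)) +
       \sum_(i <- s) \sum_(j <- s) (phi (x i - x j) (y i - y j) - m).
Proof.
move=> /(_ _ (None :: map Some s) (fun i => if i is None then z else 1)
  (fun i => if i is Some i then x i else 0) (fun i => if i is Some i then y i else 0)).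
rewrite !big_cons !big_map /= !subrr.
under [in X in _ <= X]eq_bigr do rewrite !sub0r phi_opp mulr1.
under [in X in _ <= _ + X]eq_bigr do rewrite big_cons big_map !subr0 mul1r.
rewrite big_split /= -!mulr_sumr.
under [X in _ <= _ + (_ + X)]eq_bigr do under eq_bigr do rewrite !mul1r.
have cst (c : R) : \sum_(i <- s) c = (size s)%:R * c.
  by rewrite big_const_seq count_predT iter_addr_0 mulr_natl.
rewrite cst mulr1.
under [X in _ -> _ <= _ + X]eq_bigr do rewrite sumrB cst.
rewrite !sumrB !cst.
set A := \sum_(i <- s) phi _ _; set B := \sum_(i <- s) _; set n := (size s)%:R.
have /andP[_ h00] := phi01 0 0.
have := ler_wpM2l (sqr_ge0 z) h00; rewrite mulr1 => h1.
have := mulr_ge0 m_ge0 (sqr_ge0 z).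
rewrite -expr2 => h2 h3.
have {}h3 : m * (z + n) ^+ 2 <= z ^+ 2 * phi 0 0 + 2 * z * A + B by apply: le_trans h3 _; lra.
nra.
Qed.

Variable q : rat.
Hypothesis q0 : q != 0.

(** The points [(t, q / t)] and [(u, q / u)] of the hyperbola differ by a vector
    whose coordinates have product [- q * (r - 2 + r^-1)] with [r = t / u]. *)
Let G (r : rat) := f (- q * (r - 2 + r^-1)).

Let G01 r : 0 <= G r <= 1. Proof. exact: phi01. Qed.

(** Why the mean of [f] along this rational function, which is far from affine,
    can be computed: [G (l * r)] is the value of [phi] at the point
    [(l ^ 2 * r - 2 * l + r^-1, - q / l)].  For two values of [l] the terms
    [r^-1] cancel, so the difference of the points moves along a line as [r]
    varies and [phi] has mean [m] there.  Hence the vectors attached to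
    [l = 1, ..., N] are orthogonal on average, and by Bessel's inequality their
    common correlation [M G - m] with the origin has square at most [1 / N]. *)
Lemma has_mean_G : pos_def phi m -> has_mean M G m.
Proof.
move=> pd; have hG : has_mean M G (M G) by split => //; exact: bdd_unit.
suff : M G - m = 0 by move/subr0_eq <-.
apply/eqP; rewrite -sqrf_eq0 eq_le sqr_ge0 andbT.
apply: (@archimedean_le0 _ _ 1) => N.
pose X (l : nat) (r : rat) : rat := l.+1%:R ^+ 2 * r - 2 * l.+1%:R + r^-1.
pose Y (l : nat) : rat := - q / l.+1%:R.
pose z : R := - (N%:R * (M G - m)).
have YD k l : k != l -> Y k - Y l != 0.
  move=> kl; rewrite subr_eq0; apply: contra kl => /eqP /(mulfI _).
  by rewrite oppr_eq0 => /(_ q0) /invr_inj /eqP; rewrite eqr_nat eqSS.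
have h1 (l : nat) : l \in iota 0 N -> has_mean M (fun r => phi (X l r) (Y l) - m) (M G - m).
  move=> _; apply: (has_mean_add MM); last exact: (has_mean_cst MM).
  have l0 : l.+1%:R != 0 :> rat by rewrite pnatr_eq0.
  apply: (@eq_has_mean _ _ _ (fun r => G (l.+1%:R * r + 0))) => [r|];
    last exact: (has_mean_affine MA).
  rewrite phi_hyperbola ?mulf_neq0 ?oppr_eq0 ?invr_eq0 // /G /X /Y addr0 invfM.
  by congr f; move: r^-1 => r1; field.
have h2 (k l : nat) : has_mean M (fun r => phi (X k r - X l r) (Y k - Y l) - m)
    (if k == l then phi 0 0 - m else 0).
  case: eqP => [->|/eqP kl].
    apply: (@eq_has_mean _ _ _ (fun=> phi 0 0 - m)) => [r|]; rewrite ?subrr //.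
    exact: (has_mean_cst MM).
  rewrite -[0](subrr m); apply: (has_mean_add MM); last exact: (has_mean_cst MM).
  apply: (@eq_has_mean _ _ _ (fun r =>
    phi ((k.+1%:R ^+ 2 - l.+1%:R ^+ 2) * r + (2 * l.+1%:R - 2 * k.+1%:R))
        (Y k - Y l))).
    by move=> r; congr phi; rewrite /X; ring.
  apply: has_mean_line; last exact: YD.
  rewrite subr_eq0 eqrXn2 ?ler0n // ?eqr_nat //.
have h := has_mean_add MM
  (has_mean_add MM (has_mean_cst MM (z ^+ 2))
    (has_mean_scale MM (2 * z) (has_mean_sum MM h1)))
  (has_mean_sum MM (s := iota 0 N) (fun k _ =>
    has_mean_sum MM (s := iota 0 N) (fun l _ => h2 k l))).
have := has_mean_ge MM h (fun r _ => pos_def_deviation (iota 0 N) (X^~ r) Y z pd).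
rewrite big_const_seq count_predT size_iota iter_addr_0 -[_ *+ N]mulr_natl.
have row : \sum_(k <- iota 0 N) \sum_(l <- iota 0 N) (if k == l then phi 0 0 - m else 0) <= N%:R.
  apply: (@le_trans _ _ (\sum_(k <- iota 0 N) 1)); last first.
    by rewrite big_const_seq count_predT size_iota iter_addr_0 // mulr_natl.
  rewrite big_seq [leRHS]big_seq; apply: ler_sum => k kN.
  rewrite -big_mkcond big_const_seq iter_addr_0 (eq_count (a2 := pred1 k)); last first.
    by move=> l; rewrite /= eq_sym.
  rewrite count_uniq_mem ?iota_uniq // kN mulr1n.
  by have /andP[_ ?] := phi01 0 0; have := m_ge0; lra.
move=> /le_trans /(_ (lerD (lexx _) row)) h0.
have [->|N0] := eqVneq N 0%N; first by rewrite mul0r.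
rewrite -(ler_pM2l (_ : 0 < N%:R)) ?ltr0n ?lt0n // mulr1.
have -> : N%:R * (N%:R * (M G - m) ^+ 2) = (N%:R * (M G - m)) ^+ 2 by ring.
by move: h0; rewrite /z; set e := N%:R * _; nra.
Qed.

(** Points [(t, q / t)] of the hyperbola are chosen one at a time.  By
    [has_mean_G] the correlations of a new point with the earlier ones sum to
    [0] on average over [t], so [t] can be chosen to make the sum at most [1].
    The resulting [N] vectors are almost orthogonal and have the same
    correlation [phi 1 q - m] with the origin, so Bessel's inequality bounds
    its square by [3 / N]. *)
Lemma pos_def_const : pos_def phi m -> phi 1 q = m.
Proof.
move=> pd.
pose K t u := phi (t - u) (q / t - q / u) - m.
have hK t u : t != 0 -> u != 0 -> t != u -> K t u = G (u^-1 * t + 0) - m.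
  move=> t0 u0 tu; rewrite /K phi_hyperbola; last first.
    rewrite subr_eq0; apply: contra tu => /eqP /(mulfI q0) /invr_inj ->.
    by rewrite eqxx.
  by congr (f _ - _); rewrite addr0 invfM invrK; field; rewrite t0 u0.
have Ksym t u : K t u = K u t by rewrite /K -phi_opp !opprB.
have K0 t : K t t <= 1.
  by rewrite /K !subrr; have /andP[_ ?] := phi01 0 0; have := m_ge0; lra.
have next (s : seq rat) : 0 \notin s ->
    exists2 t, t \notin 0 :: s & \sum_(u <- s) K t u <= 1.
  move=> s0; apply: contrapT => noT.
  have hs : has_mean M (fun t => \sum_(u <- s) (G (u^-1 * t + 0) - m)) (\sum_(u <- s) 0).
    apply: (has_mean_sum MM) => u us; rewrite -(subrr m).
    apply: (has_mean_add MM); last exact: (has_mean_cst MM).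
    apply: (has_mean_affine MA); last exact: has_mean_G.
    by rewrite invr_eq0; apply: contra s0 => /eqP <-.
  have := has_mean_ge_cofinite MA (s := 0 :: s) (C := 1) hs.
  rewrite big1 // ler10 => habs; suff : false by []; apply: habs => t ts.
  apply/ltW; rewrite ltNge; apply/negP => h; apply: noT; exists t => //.
  move: ts; rewrite inE negb_or => /andP[t0 ts].
  rewrite big_seq (eq_bigr (fun u => G (u^-1 * t + 0) - m)) -?big_seq // => u us.
  rewrite hK //; first by apply: contra s0 => /eqP <-.
  by apply: contra ts => /eqP ->.
have build N : exists2 s : seq rat, size s = N /\ 0 \notin s &
    \sum_(t <- s) \sum_(u <- s) K t u <= 3 * N%:R.
  elim: N => [|N [s [sN s0] IH]]; first by exists [::]; rewrite // big_nil mulr0.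
  have [t ts h] := next s s0; exists (t :: s).
    move: ts; rewrite !inE !negb_or s0 andbT => /andP[t0 _].
    by rewrite /= sN eq_sym t0.
  rewrite big_cons !big_cons.
  under [X in _ + X]eq_bigr do rewrite big_cons Ksym.
  rewrite [X in _ + X]big_split /=.
  by have := K0 t; rewrite -[N.+1%:R]natr1; move: h IH; lra.
apply/eqP; rewrite -subr_eq0 -sqrf_eq0 eq_le sqr_ge0 andbT.
apply: (@archimedean_le0 _ _ 3) => N.
have [->|N0] := eqVneq N 0%N; first by rewrite mul0r.
have [s [sN s0] h] := build N.
have := pos_def_deviation s id (fun t => q / t) (- (N%:R * (phi 1 q - m))) pd.
have -> : \sum_(t <- s) (phi t (q / t) - m) = N%:R * (phi 1 q - m).
  rewrite big_seq (eq_bigr (fun=> phi 1 q - m)) => [|t ts].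
    by rewrite -big_seq big_const_seq count_predT sN iter_addr_0 mulr_natl.
  have t0 : t != 0 by apply: contra s0 => /eqP <-.
  by rewrite -(phi_dil 1 q t0) mulr1.
move=> h2.
rewrite -(ler_pM2l (_ : 0 < N%:R)) ?ltr0n ?lt0n //.
move: (le_trans h2 (lerD (lexx _) h)).
have -> : N%:R * (N%:R * (phi 1 q - m) ^+ 2) = (N%:R * (phi 1 q - m)) ^+ 2 by ring.
by set e := N%:R * _; nra.
Qed.
End Hyperbola.

(** * Correlation functions and their averages over dilations *)

Section Correlation.
Context {R : realType} {G : zmodType} {P : (G -> R) -> R} {e : G -> R}.
Hypothesis PM : is_mean setT P.
Hypothesis Pinv : forall g h, bdd h -> P (fun x => h (g + x)) = P h.
Hypothesis e01 : forall z, 0 <= e z <= 1.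

Definition correlation (p : G) : R := P (fun z => e z * e (p + z)).

Let prod01 p q z : 0 <= e (p + z) * e (q + z) <= 1.
Proof.
have /andP[? ?] := e01 (p + z); have /andP[? ?] := e01 (q + z).
by rewrite mulr_ge0 // mulr_ile1.
Qed.

Lemma correlation01 p : 0 <= correlation p <= 1.
Proof.
by apply: (mean_unit PM) => z; have := prod01 0 p z; rewrite add0r.
Qed.

(** Expand the nonnegative mean of the square of
    [\sum_i w_i e (p_i + z) - P e * \sum_i w_i]. *)
Lemma correlation_pos (I : eqType) (s : seq I) (w : I -> R) (p : I -> G) :
  P e ^+ 2 * (\sum_(i <- s) w i) ^+ 2 <=
  \sum_(i <- s) \sum_(j <- s) w i * w j * correlation (p i - p j).
Proof.
set S := \sum_(i <- s) w i; set d := P e.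
have eb : bdd e by exact: bdd_unit.
have h1 i : i \in s -> has_mean P (fun z => w i * e (p i + z)) (w i * d).
  move=> _; apply: (has_mean_scale PM); split; last exact: Pinv.
  by apply: bdd_unit => z; exact: e01.
have h2 i j : has_mean P (fun z => w i * w j * (e (p j + z) * e (p i + z)))
    (w i * w j * correlation (p i - p j)).
  apply: (has_mean_scale PM); split; first exact/bdd_unit/prod01.
  rewrite /correlation -[RHS](Pinv (p j)).
    by congr P; apply/funext => z; rewrite addrA subrK.
  by apply: bdd_unit => z; have := prod01 0 (p i - p j) z; rewrite add0r.
have h := has_mean_add PM (has_mean_add PM
  (has_mean_sum PM (s := s) (fun i _ => has_mean_sum PM (s := s) (fun j _ => h2 i j)))
  (has_mean_scale PM (- 2 * (S * d)) (has_mean_sum PM h1)))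
  (has_mean_cst PM ((S * d) ^+ 2)).
rewrite -mulr_suml -/S in h.
set X := \sum_(i <- s) _ in h *.
have : 0 <= X + - 2 * (S * d) * (S * d) + (S * d) ^+ 2.
  apply: (has_mean_ge PM h) => z _.
  set a := \sum_(i <- s) w i * e (p i + z).
  have -> : \sum_(i <- s) \sum_(j <- s) w i * w j * (e (p j + z) * e (p i + z)) = a ^+ 2.
    rewrite expr2 /a mulr_suml; apply: eq_bigr => i _; rewrite mulr_sumr.
    by apply: eq_bigr => j _; ring.
  have -> : a ^+ 2 + - 2 * (S * d) * a + (S * d) ^+ 2 = (a - S * d) ^+ 2 by ring.
  exact: sqr_ge0.
by rewrite -exprMn [d * S]mulrC; set b := S * d; lra.
Qed.

End Correlation.

Section DilationAverage.
Context {R : realType} {N : (rat -> R) -> R} {phi : rat -> rat -> R}.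
Hypothesis NM : is_mean [set c | c != 0] N.
Hypothesis Ninv : forall a h, a != 0 -> bdd h -> N (fun c => h (a * c)) = N h.
Hypothesis phi01 : forall x y, 0 <= phi x y <= 1.

Definition dilation_average x y : R := N (fun c => phi (c * x) (y / c)).

Lemma dilation_average01 x y : 0 <= dilation_average x y <= 1.
Proof. by apply: (mean_unit NM) => c; exact: phi01. Qed.

Lemma dilation_average_inv a x y : a != 0 ->
  dilation_average (a * x) (y / a) = dilation_average x y.
Proof.
move=> a0; rewrite -[RHS](Ninv a0); last by apply: bdd_unit => c; exact: phi01.
by congr N; apply/funext => c; rewrite invfM !mulrA [c * a]mulrC.
Qed.

Lemma dilation_average_pos_def c0 : pos_def phi c0 -> pos_def dilation_average c0.
Proof.
move=> pd I s w x y.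
have h := has_mean_sum NM (s := s) (fun i _ => has_mean_sum NM (s := s) (fun j _ =>
  has_mean_scale NM (w i * w j) (@has_mean_self _ _ N _ (bdd_unit (fun c =>
    phi01 (c * (x i - x j)) ((y i - y j) / c)))))).
apply: (has_mean_ge NM h) => c c0'.
have := pd I s w (fun i => c * x i) (fun i => y i / c).
congr (_ <= _); apply: eq_bigr => i _; apply: eq_bigr => j _.
by rewrite mulrBr mulrBl.
Qed.

End DilationAverage.

(** * Differences on a hyperbola *)

(** In the coordinates [x = u - v], [y = u + v] the curve [u ^ 2 - v ^ 2 = q] is
    the hyperbola [x * y = q].  If the correlation function of the product of
    [E1] and [E2] vanished on it, then so would its average over the dilations
    [(x, y) -> (c x, y / c)], contradicting [pos_def_const].  The degenerate
    hyperbola [q = 0] contains the origin. *)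
Lemma correlation_on_hyperbola (R : realType) (E1 E2 : set rat) (q : rat) :
  (0 < upper_banach_density R E1)%E -> (0 < upper_banach_density R E2)%E ->
  exists u v, [/\ u ^+ 2 - v ^+ 2 = q, diffset E1 E1 u & diffset E2 E2 v].
Proof.
move=> /density_mean [rho1 [rho1M rho1inv d1]] /density_mean [rho2 [rho2M rho2inv d2]].
have [N [NM Ninv]] := @exists_dilation_mean R.
pose P (h : rat * rat -> R) := rho1 (fun a => rho2 (fun b => h (a, b))).
have PM : is_mean setT P by exact: (iterated_mean rho1M rho2M).
have Pinv g h : bdd h -> P (fun z => h (g + z)) = P h.
  case: g => g1 g2 hb; have [B hB] := hb.
  rewrite -[RHS](rho1inv g1); last by apply: (bdd_mean rho2M); exists B.
  congr rho1; apply/funext => a; rewrite -[RHS](rho2inv g2) //.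
  by exists B.
pose e (z : rat * rat) : R := (z.1 \in E1)%:R * (z.2 \in E2)%:R.
have ind01 (b : bool) : 0 <= (b%:R : R) <= 1 by case: b; rewrite ?lexx ?ler01.
have e01 z : 0 <= e z <= 1 by rewrite /e -natrM mulnb.
have Pe : 0 < P e.
  suff -> : P e = rho2 (fun b => (b \in E2)%:R) * rho1 (fun a => (a \in E1)%:R) by rewrite mulr_gt0.
  rewrite -(mean_scale rho1M); last exact: bdd_unit.
  congr rho1; apply/funext => a; rewrite mulrC -(mean_scale rho2M) //.
  exact: bdd_unit.
pose phi0 (x y : rat) := @correlation R _ P e ((x + y) / 2, (y - x) / 2).
have phi01 x y : 0 <= phi0 x y <= 1 by exact: correlation01.
have pd0 : pos_def phi0 (P e ^+ 2).
  move=> I s w x y.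
  have := correlation_pos PM Pinv e01 s w (fun i => ((x i + y i) / 2, (y i - x i) / 2)).
  congr (_ <= _); apply: eq_bigr => i _; apply: eq_bigr => j _.
  by congr (_ * correlation _); congr pair => /=; ring.
suff [x [y [xyq nz]]] : exists x y, x * y = q /\ phi0 x y != 0.
  exists ((x + y) / 2), ((y - x) / 2).
  have [[[a b] /=]|none] := pselect (exists z,
    e z * e (((x + y) / 2, (y - x) / 2) + z) != 0); last first.
    case/eqP: nz; rewrite /phi0 /correlation -[RHS](mean_cst PM 0).
    congr P; apply/funext => z; apply/eqP/negPn/negP => h; apply: none.
    by exists z.
  rewrite /e /= -!natrM !mulnb pnatr_eq0 eqb0 negbK => /andP[/andP[aE1 bE2] /andP[aE1' bE2']].
  split; first by rewrite -xyq; field.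
    exists ((x + y) / 2 + a); first by rewrite inE in aE1'.
    by exists a; [rewrite inE in aE1|rewrite addrK].
  exists ((y - x) / 2 + b); first by rewrite inE in bE2'.
  by exists b; [rewrite inE in bE2|rewrite addrK].
have d0 : 0 < P e ^+ 2 by rewrite exprn_gt0.
have [->|q0] := eqVneq q 0.
  exists 0, 0; split; first by rewrite mulr0.
  have := pd0 _ [:: tt] (fun=> 1) (fun=> 0) (fun=> 0).
  rewrite !big_seq1 expr1n !mulr1 mul1r !subrr => h.
  by rewrite gt_eqF // (lt_le_trans d0).
pose phi := @dilation_average R N phi0.
apply: contrapT => none.
have MA := affine_mean_of NM Ninv rho1M rho1inv.
have fphi01 : forall x y, 0 <= phi x y <= 1 by exact: dilation_average01.
have phidil c x y : c != 0 -> phi (c * x) (y / c) = phi x y by exact: dilation_average_inv.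
have pd : pos_def phi (P e ^+ 2) by exact: dilation_average_pos_def.
have phi_m := pos_def_const MA fphi01 phidil q0 (pos_def_mean MA fphi01 phidil (ltW d0) pd).
have : 0 < phi 1 q.
  by rewrite phi_m (lt_le_trans d0) // (pos_def_mean_ge MA fphi01 phidil).
suff -> : phi 1 q = 0 by rewrite ltxx.
rewrite -(mean_cst NM 0); apply: (eq_mean NM); [exact/bdd_unit|exact: bdd_cst|] => c /= c0.
apply/eqP/negPn/negP => h; apply: none; exists (c * 1), (q / c); split => //.
by field.
Qed.

Theorem corollary1p13 (R : realType) (E1 E2 : set rat)
    (hE1 : (0 < upper_banach_density R E1)%E)
    (hE2 : (0 < upper_banach_density R E2)%E) :
  diffset (sqset (diffset E1 E1)) (sqset (diffset E2 E2)) = [set: rat].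
Proof.
apply/seteqP; split => // q _.
have [u [v [<- uE vE]]] := correlation_on_hyperbola q hE1 hE2.
by exists (u ^+ 2); [exists u|exists (v ^+ 2) => //; exists v].
Qed.
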